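(* Let $n,\ell,m_x,m_y$ be positive integers and $\mathbb{Q}\subset\mathbb{R}^\ell$. Consider either of the following settings. (LMI setting) $F_0,\dots,F_{m_x}:\mathbb{Q}\to\mathbb{R}^{n\times n}$ take values in real symmetric matrices, $m_\theta=m_x$, $\theta=x\in\mathbb{R}^{m_x}$, $F(\theta,q)=F_0(q)+\sum_{i=1}^{m_x}x_iF_i(q)$. (BMI setting) $F_0,F_i,G_j,H_{ij}:\mathbb{Q}\to\mathbb{R}^{n\times n}$ ($i=1,\dots,m_x$, $j=1,\dots,m_y$) take values in real symmetric matrices, $m_\theta=m_x+m_y$, $\theta=(x,y)\in\mathbb{R}^{m_x}\times\mathbb{R}^{m_y}$, $F(\theta,q)=F_0(q)+\sum_i x_iF_i(q)+\sum_j y_jG_j(q)+\sum_{i,j}x_iy_jH_{ij}(q)$. Define $g:\mathbb{R}^{m_\theta}\times\mathbb{Q}\to\{0,1\}$ by $g(\theta,q)=0$ if $F(\theta,q)\succeq0$ (positive semidefinite) and $g(\theta,q)=1$ otherwise. Then the VC-dimension $d$ of the family $\{g(\theta,\cdot):\theta\in\mathbb{R}^{m_\theta}\}$ satisfies $$d\le 2m_\theta\log_2\!\left(4en2^n\right),$$ where $e$ is Euler's number.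
   Context: For a family $\mathcal{G}$ of functions $\mathbb{Q}\to\{0,1\}$, a finite set $\{q^{(1)},\dots,q^{(N)}\}\subset\mathbb{Q}$ is shattered by $\mathcal{G}$ if for every subset $S$ of it there is $h\in\mathcal{G}$ with $\{q^{(i)}:h(q^{(i)})=1\}=S$. The VC-dimension of $\mathcal{G}$ is the largest integer $d$ such that some set of $d$ points of $\mathbb{Q}$ is shattered by $\mathcal{G}$. *)

(* Defs.v *)
From HB Require Import structures.
From mathcomp Require Import all_boot all_order all_algebra.
From mathcomp Require Import all_classical all_reals all_analysis.
Set Implicit Arguments. Unset Strict Implicit. Unset Printing Implicit Defensive.
Import Order.TTheory GRing.Theory Num.Theory.
Local Open Scope ring_scope.

Definition symmetric_mx (R : realType) (n : nat) (A : 'M[R]_n) : Prop := A^T = A.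

Definition psd (R : realType) (n : nat) (A : 'M[R]_n) : Prop :=
  forall v : 'rV[R]_n, 0 <= (v *m A *m v^T) 0 0.

(* A family {g(th, .) : th in Th} of {0,1}-valued functions on the set Q of
   points of type P, where g(th,q) = 1 iff [one th q] holds.
   The family of N points q_1..q_N (distinct, in Q) is shattered if every subset
   S of them is cut out by some member of the family. *)
Definition shatters (P Th : Type) (Q : P -> Prop) (one : Th -> P -> Prop)
  (N : nat) (q : 'I_N -> P) : Prop :=
  injective q /\ (forall i, Q (q i)) /\
  forall S : {set 'I_N}, exists th : Th, forall i, one th (q i) <-> i \in S.

(* VC-dimension at most b (b real): every shattered finite set has size <= b.
   This says exactly that the VC-dimension exists (is finite) and is <= b. *)
Definition vc_dim_le (R : realType) (P Th : Type) (Q : P -> Prop)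
  (one : Th -> P -> Prop) (b : R) : Prop :=
  forall (N : nat) (q : 'I_N -> P), shatters Q one q -> (N%:R : R) <= b.

Definition log2 (R : realType) (x : R) : R := ln x / ln 2.

Definition vc_bound (R : realType) (mtheta n : nat) : R :=
  2 * mtheta%:R * log2 (4 * expR 1 * n%:R * 2 ^+ n).

Definition F_lmi (R : realType) (l n mx : nat) (F0 : 'rV[R]_l -> 'M[R]_n)
  (Fs : 'I_mx -> 'rV[R]_l -> 'M[R]_n) (x : 'rV[R]_mx) (q : 'rV[R]_l) : 'M[R]_n :=
  F0 q + \sum_(i < mx) x 0 i *: Fs i q.

Definition F_bmi (R : realType) (l n mx my : nat) (F0 : 'rV[R]_l -> 'M[R]_n)
  (Fs : 'I_mx -> 'rV[R]_l -> 'M[R]_n) (Gs : 'I_my -> 'rV[R]_l -> 'M[R]_n)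
  (Hs : 'I_mx -> 'I_my -> 'rV[R]_l -> 'M[R]_n)
  (th : 'rV[R]_mx * 'rV[R]_my) (q : 'rV[R]_l) : 'M[R]_n :=
  F0 q + \sum_(i < mx) th.1 0 i *: Fs i q + \sum_(j < my) th.2 0 j *: Gs j q
  + \sum_(i < mx) \sum_(j < my) (th.1 0 i * th.2 0 j) *: Hs i j q.

(* Main.v *)
(* For symmetric [A], [A] is positive semidefinite iff the [n] non-leading
   coefficients of [det (X + A)] are nonnegative, so membership is decided by the
   signs of [n] polynomials of degree at most [2 n] in theta.  If [N] points are
   shattered, [k = n N] polynomials of degree [d = 2 n] in [m] variables realise
   [2 ^ N] sign patterns.  Their number is bounded as in Warren's theorem by
   [(sum_(j <= m) 'C(k, j)) (4 d + 1) ^ m <= ((4 d + 1) e k / m) ^ m]: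
   after a shift all signs are strict, and thresholds [e_i > 0] can be chosen so
   that [f_i ^ 2 = e_i] never holds for more than [m] indices at once.  Minimise
   [h = sum_i x_i ^ (4 d + 2)] over the points of a sign cell with
   [f_i ^ 2 >= e_i], and let [S] be the active set of a minimiser; for large [T]
   the function [h + T sum_(i in S) (f_i ^ 2 - e_i) ^ 2] has a local minimum in
   the cell.  Its critical points solve [x_i ^ (4 d + 1) = p_i (x)] with
   [deg p_i <= 4 d], and interpolation on a set of such points only needs
   monomials with exponents at most [4 d]: there are at most [(4 d + 1) ^ m] of
   them, for each of the sets [S] of size at most [m]. *)
Require Import Defs.
From HB Require Import structures.
From mathcomp Require Import spectral complex.
From mathcomp Require Import all_boot all_order all_algebra.
From mathcomp Require Import all_classical all_reals all_analysis.
From mathcomp Require Import zify ring lra perm.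
Import Order.TTheory GRing.Theory Num.Theory.
Import numFieldNormedType.Exports.
Local Open Scope ring_scope.

(** * Polynomial functions of bounded total degree *)

Section PolynomialFunctions.
Context {F : fieldType} {m : nat}.
Implicit Types (f g : 'rV[F]_m -> F) (a : 'I_m -> nat).

Definition mono a (x : 'rV[F]_m) : F := \prod_i x 0 i ^+ a i.

(** Polynomials are kept as functions generated by monomials, so that linear statements about them
    reduce by induction to monomials. *)
Inductive pdeg (d : nat) : ('rV[F]_m -> F) -> Prop :=
| pdeg_mono c a : (\sum_i a i <= d)%N -> pdeg d (fun x => c * mono a x)
| pdegD f g : pdeg d f -> pdeg d g -> pdeg d (fun x => f x + g x).

Lemma eq_pdeg {d f} g : f =1 g -> pdeg d f -> pdeg d g.
Proof. by move=> /funext ->. Qed.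

Lemma pdegW {d} e f : (d <= e)%N -> pdeg d f -> pdeg e f.
Proof.
move=> de; elim=> [c a ad|{}f g _ fe _ ge]; last exact: pdegD.
by apply: pdeg_mono; apply: leq_trans de.
Qed.

Lemma pdeg_cst d c : pdeg d (fun=> c).
Proof.
apply: (@eq_pdeg _ (fun x => c * mono (fun=> 0%N) x)).
  by move=> x; rewrite /mono big1 ?mulr1.
by apply: pdeg_mono; rewrite big1.
Qed.

Lemma monoX j n (x : 'rV[F]_m) : mono (fun i => (i == j) * n)%N x = x 0 j ^+ n.
Proof.
rewrite /mono (bigD1 j) //= eqxx mul1n big1 ?mulr1 // => i /negPf ->.
by rewrite mul0n.
Qed.

Lemma sum_deltan j n : (\sum_(i < m) (i == j) * n)%N = n.
Proof.
by rewrite (bigD1 j) //= eqxx mul1n big1 ?addn0 // => i /negPf ->.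
Qed.

Lemma pdeg_coordX j n : pdeg n (fun x => x 0 j ^+ n).
Proof.
apply: (@eq_pdeg _ (fun x => 1 * mono (fun i => (i == j) * n)%N x)).
  by move=> x; rewrite mul1r monoX.
by apply: pdeg_mono; rewrite sum_deltan.
Qed.

Lemma pdeg_coord j : pdeg 1 (fun x => x 0 j).
Proof. exact: pdeg_coordX j 1. Qed.

Lemma monoD a b (x : 'rV[F]_m) : mono (fun i => a i + b i)%N x = mono a x * mono b x.
Proof. by rewrite /mono -big_split; apply: eq_bigr => i _; rewrite exprD. Qed.

Lemma pdegM d e f g : pdeg d f -> pdeg e g -> pdeg (d + e) (fun x => f x * g x).
Proof.
move=> fd ge; elim: fd => [c a ad|f1 f2 _ h1 _ h2]; last first.
  by apply: eq_pdeg (pdegD _ _ _ h1 h2) => x; rewrite mulrDl.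
elim: ge => [c' b be|g1 g2 _ h1 _ h2]; last first.
  by apply: eq_pdeg (pdegD _ _ _ h1 h2) => x; rewrite mulrDr.
apply: (@eq_pdeg _ (fun x => (c * c') * mono (fun i => a i + b i)%N x)).
  by move=> x; rewrite monoD mulrACA.
by apply: pdeg_mono; rewrite big_split leq_add.
Qed.

Lemma pdegZ d c f : pdeg d f -> pdeg d (fun x => c * f x).
Proof. by move=> fd; have := pdegM _ _ _ _ (pdeg_cst 0 c) fd. Qed.

Lemma pdegB d f g : pdeg d f -> pdeg d g -> pdeg d (fun x => f x - g x).
Proof.
move=> fd gd; apply: eq_pdeg (pdegD _ _ _ fd (pdegZ _ (-1) _ gd)) => x.
by rewrite mulN1r.
Qed.

Lemma pdegX d f n : pdeg d f -> pdeg (d * n) (fun x => f x ^+ n).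
Proof.
move=> fd; elim: n => [|n IHn].
  by apply: eq_pdeg (pdeg_cst _ 1) => x; rewrite expr0.
by rewrite mulnS; apply: eq_pdeg (pdegM _ _ _ _ fd IHn) => x; rewrite exprS.
Qed.

Lemma pdeg_sum d (I : Type) (r : seq I) (P : pred I) (f : I -> 'rV[F]_m -> F) :
  (forall i, P i -> pdeg d (f i)) -> pdeg d (fun x => \sum_(i <- r | P i) f i x).
Proof.
move=> fd; elim: r => [|i r IHr].
  by apply: eq_pdeg (pdeg_cst _ 0) => x; rewrite big_nil.
have [Pi|Pi] := boolP (P i); last first.
  by apply: eq_pdeg IHr => x; rewrite big_cons (negPf Pi).
by apply: eq_pdeg (pdegD _ _ _ (fd _ Pi) IHr) => x; rewrite big_cons Pi.
Qed.

Lemma pdeg_prod d (I : Type) (r : seq I) (P : pred I) (f : I -> 'rV[F]_m -> F) :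
  (forall i, P i -> pdeg d (f i)) ->
  pdeg (count P r * d) (fun x => \prod_(i <- r | P i) f i x).
Proof.
move=> fd; elim: r => [|i r IHr].
  by apply: eq_pdeg (pdeg_cst _ 1) => x; rewrite big_nil.
have [Pi|Pi] := boolP (P i) => /=; last first.
  by rewrite (negPf Pi); apply: eq_pdeg IHr => x; rewrite big_cons (negPf Pi).
by rewrite Pi mulSn; apply: eq_pdeg (pdegM _ _ _ _ (fd _ Pi) IHr) => x; rewrite big_cons Pi.
Qed.

Lemma pdeg_prod_card d (I : finType) (P : pred I) (f : I -> 'rV[F]_m -> F) :
  (forall i, P i -> pdeg d (f i)) -> pdeg (#|P| * d) (fun x => \prod_(i | P i) f i x).
Proof.
rewrite -sum1_card sum1_count => fd; exact: pdeg_prod.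
Qed.

(** * Counting points by interpolation *)

Section Evaluation.
Variables (T : finType) (p : T -> 'rV[F]_m).

(** Interpolation becomes linear algebra: functions dual to the points [p t] are sent to the
    standard basis. *)
Definition evl f : 'rV[F]_#|T| := \row_j f (p (enum_val j)).

Lemma evlD f g : evl (fun x => f x + g x) = evl f + evl g.
Proof. by apply/rowP => j; rewrite !mxE. Qed.

Lemma evlZ c f : evl (fun x => c * f x) = c *: evl f.
Proof. by apply/rowP => j; rewrite !mxE. Qed.

Definition mono_seq (B : nat) : seq 'rV[F]_#|T| :=
  [seq evl (mono (fun i => a i)) | a : {ffun 'I_m -> 'I_B}].

Lemma evl_mono_box B a : (forall i, (a i < B)%N) -> evl (mono a) \in <<mono_seq B>>%VS.
Proof.
move=> aB; apply: memv_span; apply/mapP.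
exists [ffun i => Ordinal (aB i)]; first by rewrite mem_enum.
by congr evl; apply: funext => x; apply: eq_bigr => i _; rewrite ffunE.
Qed.

Lemma evl_pdeg d (U : {vspace 'rV[F]_#|T|}) f :
  (forall a, (\sum_i a i <= d)%N -> evl (mono a) \in U) -> pdeg d f -> evl f \in U.
Proof.
move=> aU; elim=> [c a ad|f1 f2 _ h1 _ h2]; first by rewrite evlZ memvZ ?aU.
by rewrite evlD memvD.
Qed.

Lemma evl_pdeg_box d B f : (d < B)%N -> pdeg d f -> evl f \in <<mono_seq B>>%VS.
Proof.
move=> dB; apply: evl_pdeg => a ad; apply: evl_mono_box => i.
by apply: leq_ltn_trans dB; apply: leq_trans ad; rewrite (bigD1 i) //= leq_addr.
Qed.

(** The vectors [evl (f t)] form the standard basis, so the [B ^ m] monomials span a space of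
    dimension [#|T|]. *)
Lemma card_interpolation B (f : T -> 'rV[F]_m -> F) :
  (forall t s, f t (p s) = (t == s)%:R) ->
  (forall t, evl (f t) \in <<mono_seq B>>%VS) -> (#|T| <= B ^ m)%N.
Proof.
move=> fE fU; have fullU : (fullv <= <<mono_seq B>>)%VS.
  apply/subvP => v _; rewrite [v]row_sum_delta memv_suml // => j _.
  apply: memvZ; rewrite (_ : delta_mx _ _ = evl (f (enum_val j))) //.
  by apply/rowP => k; rewrite !mxE fE eqxx (inj_eq enum_val_inj) eq_sym.
apply: leq_trans (_ : \dim (<<mono_seq B>>)%VS <= _)%N.
  by have := dimvS fullU; rewrite dimvf /dim /= mul1n.
apply: leq_trans (dim_span _) _.
by rewrite size_map -cardE card_ffun !card_ord.
Qed.

Lemma interpolation_deg_bound B d (f : T -> 'rV[F]_m -> F) : (d < B)%N ->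
  (forall t, pdeg d (f t)) -> (forall t s, f t (p s) = (t == s)%:R) ->
  (#|T| <= B ^ m)%N.
Proof.
move=> dB fd fE; apply: card_interpolation fE _ => t.
exact: evl_pdeg_box (fd t).
Qed.

(* On the solutions, [x_i ^+ E] may be replaced by a polynomial of smaller
   degree, so that every polynomial reduces to exponents below [E]. *)
Lemma card_triangular_system E (g : 'I_m -> 'rV[F]_m -> F) :
  injective p -> (forall i, pdeg E (g i)) ->
  (forall i t, p t 0 i ^+ E.+1 = g i (p t)) -> (#|T| <= E.+1 ^ m)%N.
Proof.
move=> p_inj gE pE.
(* Induction on the total degree: trading [x_j ^ E.+1] for [g j], of degree at most [E], lowers
   it. *)
have red d a : (\sum_i a i <= d)%N -> evl (mono a) \in <<mono_seq E.+1>>%VS.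
  elim: d a => [|d IHd] a ad.
    apply: evl_mono_box => i; apply: leq_ltn_trans (ltn0Sn _).
    by apply: leq_trans ad; rewrite (bigD1 i) //= leq_addr.
  have [/forallP aE|] := boolP [forall i, (a i < E.+1)%N]; first exact: evl_mono_box.
  rewrite negb_forall => /existsP[j]; rewrite -leqNgt => Eaj.
  pose b i := (a i - (i == j) * E.+1)%N.
  have ab i : a i = ((i == j) * E.+1 + b i)%N.
    by rewrite /b subnKC //; case: eqP => [->|]; rewrite ?mul1n.
  have sa : (\sum_i a i = E.+1 + \sum_i b i)%N.
    by rewrite (eq_bigr _ (fun i _ => ab i)) big_split sum_deltan.
  rewrite (_ : evl _ = evl (fun x => g j x * (1 * mono b x))); last first.
    apply/rowP => k; rewrite !mxE mul1r -pE -monoX -monoD.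
    by apply: eq_bigr => i _; rewrite -ab.
  apply: (@evl_pdeg d); first exact: IHd.
  apply: (@pdegW (E + \sum_i b i)); first by rewrite -ltnS -addSn -sa.
  by apply: pdegM => //; apply: pdeg_mono.
(* An affine function of a coordinate separating [p t] from [p s]; the default [1] occurs only when
   the points coincide, that is for [t = s]. *)
pose q t s (x : 'rV[F]_m) := if [pick j | p t 0 j != p s 0 j] is Some j
  then (p t 0 j - p s 0 j)^-1 * (x 0 j - p s 0 j) else 1.
have qd t s : pdeg 1 (q t s).
  rewrite /q; case: pickP => [j _|_]; last exact: pdeg_cst.
  by apply: pdegZ; apply: pdegB (pdeg_coord j) (pdeg_cst _ _).
have q1 t s : q t s (p t) = 1.
  by rewrite /q; case: pickP => // j ts; rewrite mulVf ?subr_eq0.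
have q0 t s : t != s -> q t s (p s) = 0.
  rewrite /q; case: pickP => [j _|pts]; first by rewrite subrr mulr0.
  case/eqP; apply: p_inj; apply/rowP => j.
  by apply/eqP; have := pts j; case: eqP.
pose f t x := \prod_(s | s != t) q t s x.
apply: (card_interpolation _ f) => [t s|t].
  have [->|ts] := eqVneq t s; first by rewrite /f big1.
  have st : s != t by rewrite eq_sym.
  by rewrite /f (bigD1 s st) /= q0 ?mul0r.
apply: evl_pdeg (pdeg_prod 1 _ _ _ _ _) => [a ad|s _]; last exact: qd.
exact: red ad.
Qed.
End Evaluation.
End PolynomialFunctions.

(** * Generic threshold values *)

Section GenericLevels.
Context {R : realFieldType} {m : nat} {I : finType}.

(** Products over [S] of Lagrange polynomials in the values [v i] separate the tuples of [T]. Their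
    degree is at most [#|S| * L.+1 * D], so the interpolation bound applies to the points [x c]. *)
Lemma card_attained_levels (L D : nat) (g : 'I_L.+1 -> R) (v : I -> 'rV[R]_m -> R)
    (S : {set I}) (T : {set {ffun I -> 'I_L.+1}}) (x : {ffun I -> 'I_L.+1} -> 'rV[R]_m) :
  injective g -> (0 < #|S|)%N -> (forall i, pdeg D (v i)) ->
  (forall c i, c \in T -> i \notin S -> c i = ord0) ->
  (forall c i, c \in T -> i \in S -> v i (x c) = g (c i)) ->
  (#|T| <= (#|S| * D.+1 * L.+1) ^ m)%N.
Proof.
move=> g_inj S_gt0 vD T0 vg.
pose l (j : 'I_L.+1) (y : R) := \prod_(j' | j' != j) ((g j - g j')^-1 * (y - g j')).
have lE j j' : l j (g j') = (j == j')%:R.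
  have [<-|jj'] := eqVneq j j'.
    by apply: big1 => k kj; rewrite mulVf // subr_eq0 (inj_eq g_inj) eq_sym.
  have j'j : j' != j by rewrite eq_sym.
  by rewrite /l (bigD1 j' j'j) /= subrr mulr0 mul0r.
pose f (t : {c | c \in T}) y := \prod_(i in S) l (val t i) (v i y).
rewrite -card_sig.
apply: (@interpolation_deg_bound _ _ _ (fun t => x (val t)) _ (#|S| * (L.+1 * D)) f).
- by rewrite mulnAC -mulnA ltn_mul2l S_gt0 ltn_mul2l /= ltnSn.
- move=> t; apply: pdeg_prod_card => i iS.
  apply: (@pdegW _ _ (#|[pred j' | j' != val t i]| * D)).
    by rewrite leq_mul2r -[X in (_ <= X)%N]card_ord max_card orbT.
  apply: pdeg_prod_card => j _.
  by apply: pdegZ; apply: pdegB (pdeg_cst _ _).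
- move=> t s; rewrite /f; have [->|ts] := eqVneq t s.
    by apply: big1 => i iS; rewrite vg ?(valP s) // lE eqxx.
  (* Off [S] both tuples are [ord0], so distinct ones differ at an index of [S]. *)
  case: (pickP (fun i : I => val t i != val s i)) => [i tsi|ts0]; last first.
    case/eqP: ts; apply/val_inj/ffunP => i.
    by apply/eqP; have := ts0 i; case: eqP.
  have [iS|iS] := boolP (i \in S); last by move: tsi; rewrite !T0 ?eqxx // ?(valP t) ?(valP s).
  by rewrite (bigD1 i iS) /= vg ?(valP s) // lE (negPf tsi) mul0r.
Qed.

(* At most [m] of [k] polynomials in [m] variables take prescribed generic
   values simultaneously: on a grid of [L ^ k] candidate values, those attained
   by [m + 1] of them have proportion [O(1 / L)]. *)
Lemma generic_levels (D : nat) (v : I -> 'rV[R]_m -> R) (eta : R) :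
  0 < eta -> (forall i, pdeg D (v i)) ->
  exists e : I -> R, (forall i, 0 < e i < eta) /\
    forall x, (#|[set i | v i x == e i]| <= m)%N.
Proof.
move=> eta0 vD.
(* With this [L] a union bound over the sets [U] of [m.+1] indices fails to cover all tuples: each
   of the at most [2 ^ #|I|] sets accounts for at most [B ^ m * L.+1 ^ (#|I|.-1)] of the
   [L.+1 ^ #|I|] tuples. *)
pose B := (m.+1 * D.+1)%N; pose L := (2 ^ #|I| * B ^ m)%N.
pose g (j : 'I_L.+1) : R := eta * (j.+1%:R / L.+2%:R).
have g_inj : injective g.
  move=> j j' /(mulfI (lt0r_neq0 eta0)) /mulIf; rewrite invr_eq0 pnatr_eq0 => /(_ isT).
  by move/eqP; rewrite eqr_nat eqSS => /eqP/val_inj.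
have gP j : 0 < g j < eta.
  rewrite /g mulr_gt0 ?divr_gt0 ?ltr0n //= gtr_pMr // ltr_pdivrMr ?ltr0n //.
  by rewrite mul1r ltr_nat ltnS ltn_ord.
have [[c cP]|bad] := pselect (exists c : {ffun I -> 'I_L.+1},
    forall x, (#|[set i | v i x == g (c i)]| <= m)%N).
  by exists (fun i => g (c i)); split => // i; exact: gP.
exfalso.
have badP (c : {ffun I -> 'I_L.+1}) : exists x, (m < #|[set i | v i x == g (c i)]|)%N.
  apply/not_existsP => h; apply: bad; exists c => x.
  by rewrite leqNgt; apply/negP => hx; apply: (h x).
pose x c := projT1 (cid (badP c)).
pose A c := [set i | v i (x c) == g (c i)].
have xP c : (m < #|A c|)%N by rewrite /A /x; case: cid.
have subP c : {S : {set I} | (S \subset A c) && (#|S| == m.+1)}.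
  case: (pickP (fun S : {set I} => (S \subset A c) && (#|S| == m.+1))) => [S|noS].
    by exists S.
  exfalso; have := cards_draws (A c) m.+1.
  have -> : [set S : {set I} | S \subset A c & #|S| == m.+1] = finset.set0.
    by apply/setP => S; rewrite !inE noS.
  by move/esym; rewrite cards0 => /eqP; rewrite -leqn0 leqNgt bin_gt0 xP.
pose S c := val (subP c).
have SA c : S c \subset A c by have /andP[] := valP (subP c).
have cS c : #|S c| = m.+1 by have /andP[_ /eqP] := valP (subP c).
have mI : (m < #|I|)%N by rewrite -(cS [ffun=> ord0]) max_card.
pose r (U : {set I}) (c : {ffun I -> 'I_L.+1}) := [ffun i => if i \in U then c i else ord0].
pose C U := [set c | S c == U].
(* The part of a tuple on [U] consists of attained levels and is counted by [card_attained_levels];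
   the part off [U] is free. *)
have cardC (U : {set I}) : (#|C U| <= (B * L.+1) ^ m * L.+1 ^ (#|I| - m.+1))%N.
  have [/eqP->|/finset.set0Pn[c0]] := boolP (C U == finset.set0); first by rewrite cards0.
  rewrite inE => /eqP c0U; have cU : #|U| = m.+1 by rewrite -c0U cS.
  pose T := r U @: C U.
  pose h c := (r U c, r (~: U) c).
  have h_inj : injective h.
    move=> c c' [] /ffunP h1 /ffunP h2; apply/ffunP => i.
    by have := h1 i; have := h2 i; rewrite !ffunE inE; case: (i \in U).
  rewrite -(card_imset _ h_inj).
  apply: (@leq_trans #|finset.setX T [set c | c \in pffun_on ord0 (~: U) predT]|).
    apply: subset_leq_card; apply/fintype.subsetP => _ /imsetP[c cC ->].
    rewrite !inE; apply/andP; split; first exact: imset_f.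
    apply/pffun_onP; split => //.
    by apply/fintype.subsetP => i; rewrite !inE !ffunE inE; case: (i \in U) => //=; rewrite eqxx.
  rewrite cardsX cardsE card_pffun_on card_ord (cardsCs (~: U)) finset.setCK cU leq_mul2r; apply/orP; right.
  (* On [T] the search always succeeds; [c0] only makes [s] total. *)
  pose s c' := odflt c0 [pick c in C U | r U c == c'].
  have sP c' : c' \in T -> s c' \in C U /\ r U (s c') = c'.
    case/imsetP => c cC ->; rewrite /s; case: pickP => [c1 /andP[? /eqP]//|/(_ c)].
    by rewrite cC eqxx.
  have := @card_attained_levels L D g v U T (fun c' => x (s c')) g_inj.
  rewrite cU => /(_ isT vD) ->//.
    by move=> c i /sP[_ <-] /negPf iU; rewrite ffunE iU.
  move=> c i /sP[]; rewrite inE => /eqP sU rU iU.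
  have : i \in A (s c) by apply: (fintype.subsetP (SA _)); rewrite sU.
  by rewrite inE => /eqP ->; rewrite -{2}rU ffunE iU.
have : (\sum_(U : {set I}) #|C U| <=
        \sum_(U : {set I}) (B * L.+1) ^ m * L.+1 ^ (#|I| - m.+1))%N.
  by apply: leq_sum => U _; exact: cardC.
have := card_powerset [set: I]; rewrite powersetT !cardsT sum_nat_const => ->.
have -> : (\sum_(U : {set I}) #|C U| = L.+1 ^ #|I|)%N.
  rewrite -[in RHS](card_ord L.+1) -card_ffun -sum1_card (partition_big S predT) //=.
  by apply: eq_bigr => U _; rewrite sum1_card; apply: eq_card => c; rewrite !inE.
rewrite leqNgt => /negP; apply.
rewrite expnMn -mulnA -expnD mulnA -/L.
have -> : (m + (#|I| - m.+1) = #|I|.-1)%N by lia.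
by rewrite -[in X in (_ < X)%N](ltn_predK mI) expnS ltn_mul2r expn_gt0 /= ltnSn.
Qed.
End GenericLevels.

(** * Penalty functions and local minima *)

Section PenaltyMethod.
Context {R : realType} {E : topologicalType} {I : finType}.
Variables (h : E -> R) (f : I -> E -> R) (e : I -> R) (theta : E).
Hypotheses (h_cont : continuous h) (h_ge0 : forall x, 0 <= h x)
  (h_proper : forall c, compact [set x | h x <= c]%classic)
  (f_cont : forall i, continuous (f i)) (e_gt0 : forall i, 0 < e i)
  (f_theta : forall i, 0 < f i theta) (e_theta : forall i, e i <= f i theta ^+ 2).

Lemma continuous_sqr (g : E -> R) : continuous g -> continuous (fun x => g x ^+ 2).
Proof. by move=> gc x; apply: continuousM; exact: gc. Qed.

Lemma closed_sublevel (g : E -> R) c : continuous g -> closed [set x | g x <= c]%classic.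
Proof.
move=> gc; apply: (@preimage_closed _ _ g [set y | y <= c]%classic) => [x _|].
  exact: gc.
exact: closed_le.
Qed.

Lemma closed_superlevel (g : E -> R) c : continuous g -> closed [set x | c <= g x]%classic.
Proof.
move=> gc; apply: (@preimage_closed _ _ g [set y | c <= y]%classic) => [x _|].
  exact: gc.
exact: closed_ge.
Qed.

(** The bounds [b] are arbitrary because both [e] and its relaxation on the active set are
    needed. *)
Lemma closed_lower_bounds (b : I -> R) :
  closed [set x | forall i, 0 <= f i x /\ b i <= f i x ^+ 2]%classic.
Proof.
rewrite (_ : [set _ | _]%classic = (\bigcap_(i in setT)
    ([set x | 0 <= f i x] `&` [set x | b i <= f i x ^+ 2]))%classic); last first.
  by apply/seteqP; split => [x xP i _|x xP i]; [exact: xP | exact: (xP i Logic.I)].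
apply: closed_bigI => i _; apply: closedI.
  by apply: closed_superlevel; exact: f_cont.
by apply: closed_superlevel; apply: continuous_sqr; exact: f_cont.
Qed.

Lemma proper_min (A : set E) (g : E -> R) c : closed A ->
  (forall x, A x -> h x <= c) -> (exists x, A x) -> continuous g ->
  exists2 x, A x & forall y, A y -> g x <= g y.
Proof.
move=> Ac Ah A0 gc.
have cA : compact A by apply: subclosed_compact Ac (h_proper c) _ => x /Ah.
have [x] := compact_EVT_min A0 cA (continuous_subspaceT gc).
by rewrite inE => xA xP; exists x => // y yA; apply: xP; rewrite inE.
Qed.

Lemma continuous_sum_sqr (S : {set I}) :
  continuous (fun x => \sum_(i in S) (f i x ^+ 2 - e i) ^+ 2).
Proof.
apply: continuous_big => [|i _]; first exact: add_continuous.
apply: continuous_sqr => x.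
apply: cvgB; last exact: cvg_cst.
by apply: continuous_sqr; exact: f_cont.
Qed.

(* The active set is maximal among the minimisers of [h] under the constraints
   [f_i ^+ 2 >= e_i], so that near the minimisers having this active set the
   value of [h] cannot be attained again on the equality constraints. *)
Lemma penalty_local_min : exists x0, let S := [set i | f i x0 ^+ 2 == e i] in
  exists T0, forall T, T0 <= T -> exists y, (forall i, 0 < f i y) /\
    (\forall z \near y,
       h y + T * \sum_(i in S) (f i y ^+ 2 - e i) ^+ 2
       <= h z + T * \sum_(i in S) (f i z ^+ 2 - e i) ^+ 2).
Proof.
pose K := [set x | forall i, 0 <= f i x /\ e i <= f i x ^+ 2]%classic.
have theta_K : K theta by move=> i; rewrite ltW.
have [x1 [x1K _] x1P] : exists2 x, (K `&` [set x | h x <= h theta])%classic x &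
    forall y, (K `&` [set x | h x <= h theta])%classic y -> h x <= h y.
  apply: (@proper_min _ _ (h theta)) => //; last by exists theta; split => /=.
    by apply: closedI; [exact: closed_lower_bounds | exact: closed_sublevel].
  by move=> x [].
have {}x1P y : K y -> h x1 <= h y.
  move=> yK; have [hy|/ltW hy] := leP (h y) (h theta); first by apply: x1P; split.
  by apply: le_trans hy; apply: x1P; split => /=.
pose act x := [set i | f i x ^+ 2 == e i].
pose P k := `[< exists x, [/\ K x, h x = h x1 & #|act x| = k] >].
have exP : exists k, P k by exists #|act x1|; apply/asboolP; exists x1.
have Pmax k : P k -> (k <= #|I|)%N by move/asboolP => [x [_ _ <-]]; exact: max_card.
case: (ex_maxnP exP Pmax) => k /asboolP[x0 [x0K hx0 x0k]] kmax.
exists x0 => S.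
(* Halving the active bounds makes room around [x0]; the others are kept, so that one of them
   becoming tight enlarges the active set. *)
pose b i := if i \in S then e i / 2 else e i.
have b_gt0 i : 0 < b i by rewrite /b; case: ifP; rewrite ?divr_gt0.
pose W := ([set x | forall i, 0 <= f i x /\ b i <= f i x ^+ 2] `&`
  [set x | h x <= h x1 + 1])%classic.
have W_closed : closed W by apply: closedI; [exact: closed_lower_bounds | exact: closed_sublevel].
pose g x := \sum_(i in S) (f i x ^+ 2 - e i) ^+ 2.
have g_cont : continuous g by exact: continuous_sum_sqr.
have g_ge0 x : 0 <= g x by apply: sumr_ge0 => i _; exact: sqr_ge0.
(* The obstruction to an interior minimiser: some bound is tight although [h] does not exceed its
   minimum over [K]. *)
pose B := ((W `&` [set x | h x <= h x1]) `&`
  \bigcup_(i in setT) [set x | f i x ^+ 2 <= b i])%classic.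
have B_closed : closed B.
  apply: closedI; first by apply: closedI => //; exact: closed_sublevel.
  apply: closed_bigcup; first exact: finite_finset.
  by move=> i _; apply: closed_sublevel; apply: continuous_sqr; exact: f_cont.
(* If [g x = 0], then [x] minimises [h] over [K], and its active set contains [S] and the tight
   index, which lies off [S] because [b i < e i] on [S]. This contradicts maximality. *)
have g_gt0 x : B x -> 0 < g x.
  move=> [[[xb _] hx] [i _ /= xi]]; rewrite lt0r g_ge0 andbT.
  apply/negP; rewrite psumr_eq0 => [/allP g0|j _]; last exact: sqr_ge0.
  have xS j : j \in S -> f j x ^+ 2 = e j.
    move=> jS; have := g0 j; rewrite mem_index_enum jS /= sqrf_eq0 subr_eq0.
    by move=> /(_ isT)/eqP.
  have xK : K x.
    move=> j; have [? bj] := xb j; split => //; move: bj; rewrite /b.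
    by case: ifP => // jS; rewrite xS.
  have iS : i \notin S.
    apply/negP => iS; move: xi; rewrite xS // /b iS leNgt => /negP; apply.
    by have := e_gt0 i; lra.
  have iact : i \in act x.
    by rewrite inE eq_le (xK i).2 andbT; move: xi; rewrite /b (negPf iS).
  have : P #|act x|.
    by apply/asboolP; exists x; split => //; apply/eqP; rewrite eq_le hx x1P.
  move/kmax; rewrite -x0k leqNgt => /negP; apply; apply: proper_card.
  apply/properP; split; first by apply/fintype.subsetP => j /xS xj; rewrite inE xj.
  by exists i.
have [gam gam0 gamP] : exists2 gam, 0 < gam & forall x, B x -> gam <= g x.
  have [B0|B0] := pselect (exists x, B x); last first.
    by exists 1 => // x xB; case: B0; exists x.
  have [x xB xP] : exists2 x, B x & forall y, B y -> g x <= g y.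
    by apply: (@proper_min _ _ (h x1)) => // x [[_ ]].
  by exists (g x); [exact: g_gt0 | exact: xP].
(* Then [T * gam > h x1], whereas the penalised minimum over [W] is at most [h x1], its value at
   [x0]. As [h] is nonnegative, the minimiser avoids [B]. *)
exists (h x1 / gam + 1) => T TP.
have T0 : 0 < T by apply: lt_le_trans TP; rewrite ltr_wpDl ?divr_ge0 // ltW.
have x0S i : i \in S -> f i x0 ^+ 2 = e i by rewrite inE => /eqP.
have x0W : W x0.
  split => [i|/=]; last by rewrite hx0 lerDl.
  have [? ei] := x0K i; split => //; apply: le_trans ei.
  by rewrite /b; case: ifP => // _; have := e_gt0 i; lra.
have gx0 : g x0 = 0 by apply: big1 => i /x0S ->; rewrite subrr expr0n.
have [y [yb hy] yP] : exists2 y, W y & forall z, W z -> h y + T * g y <= h z + T * g z.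
  apply: (@proper_min _ _ (h x1 + 1)) => //; [by move=> x []|by exists x0|].
  move=> x; apply: cvgD; first exact: h_cont.
  by apply: cvgM; [exact: cvg_cst | exact: g_cont].
have yx1 : h y + T * g y <= h x1 by have := yP _ x0W; rewrite gx0 mulr0 addr0 hx0.
have hyx1 : h y <= h x1 by apply: le_trans yx1; rewrite lerDl mulr_ge0 // ltW.
have yb' i : b i < f i y ^+ 2.
  rewrite ltNge; apply/negP => yi.
  have yB : B y by split => //; exists i.
  have : h x1 < T * g y.
    apply: (@lt_le_trans _ _ (T * gam)); last by rewrite ler_pM2l // gamP.
    by rewrite -ltr_pdivrMr //; apply: lt_le_trans TP; rewrite ltrDl.
  by rewrite ltNge => /negP; apply; apply: le_trans yx1; rewrite lerDr.
have fy i : 0 < f i y.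
  have [fi _] := yb i; rewrite lt0r fi andbT; apply/negP => /eqP fi0.
  by have := yb' i; rewrite fi0 expr0n /= ltNge ltW.
exists y; split => //.
have near_gt (u : E -> R) c : continuous u -> c < u y -> \forall z \near y, c < u z.
  by move=> uc cy; apply: (uc y) (lt_nbhsr cy).
(* All constraints of [W] are strict at [y], so the minimum over [W] is a local minimum in the whole
   space. *)
have near_f : \forall z \near y, forall i, 0 < f i z /\ b i < f i z ^+ 2.
  apply: filter_forall => i; near=> z; split; near: z.
    exact: near_gt.
  by apply: near_gt => //; apply: continuous_sqr.
have near_h : \forall z \near y, h z < h x1 + 1.
  have : h y < h x1 + 1 by rewrite (le_lt_trans hyx1) // ltrDl.
  by move=> hlt; apply: (h_cont y) (lt_nbhsl hlt).
near=> z; apply: yP; split => [i|].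
  have zf : forall i, 0 < f i z /\ b i < f i z ^+ 2 by near: z.
  by have [/ltW ? /ltW ?] := zf i.
by apply: ltW; near: z.
Unshelve. all: end_near.
Qed.
End PenaltyMethod.

(** * Semidefiniteness and the characteristic polynomial *)

Section PsdCharPoly.
Local Open Scope sesquilinear_scope.
Context {R : realType} {n : nat}.
Implicit Types (A : 'M[R]_n).
Local Notation rC := (map_mx (real_complex R)).

Lemma conjE (z : R[i]) : Num.conj z = (complex.Re z)%:C%C - 'i%C * (complex.Im z)%:C%C.
Proof. by case: z => x y; apply/eqP; rewrite eq_complex /=; apply/andP; split; apply/eqP; ring. Qed.

(** For [v = a + i b], symmetry cancels the cross terms and leaves the quadratic form at [a] plus
    that at [b]. *)
Lemma psd_complex A (v : 'rV[R[i]]_n) :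
  symmetric_mx A -> psd A -> 0 <= (v *m rC A *m v^t*) 0 0.
Proof.
move=> symA psdA; pose a := map_mx (@complex.Re R) v; pose b := map_mx (@complex.Im R) v.
have vE : v = rC a + 'i%C *: rC b by apply/rowP => j; rewrite !mxE -complexE.
have vtE : v^t* = rC a^T - 'i%C *: rC b^T.
  apply/colP => j; rewrite !mxE; exact: conjE.
have abT : b *m A *m a^T = a *m A *m b^T.
  rewrite [LHS]mx11_scalar [RHS]mx11_scalar; congr (_ %:M).
  have -> : (a *m A *m b^T) 0 0 = ((a *m A *m b^T)^T) 0 0 by rewrite [RHS]mxE.
  by rewrite !trmx_mul trmxK symA mulmxA.
rewrite (_ : _ *m _ *m _ = rC (a *m A *m a^T + b *m A *m b^T)); last first.
  rewrite vtE vE mulmxDl !mulmxBr !mulmxDl -!scalemxAl -!scalemxAr -!map_mxM abT.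
  rewrite map_mxD scalerA -expr2 sqr_i scaleN1r opprD opprK addrACA.
  by rewrite addrAC -!addrA; congr (_ + _); rewrite addrC -!addrA addNr addr0.
by rewrite mxE ler0c mxE addr_ge0 ?psdA.
Qed.

Lemma dotmx_self (v : 'rV[R[i]]_n) : (v *m v^t*) 0 0 = \sum_j `|v 0 j| ^+ 2.
Proof. by rewrite mxE; apply: eq_bigr => j _; rewrite normCK !mxE. Qed.

Lemma dotmx_gt0 (v : 'rV[R[i]]_n) : v != 0 -> 0 < (v *m v^t*) 0 0.
Proof.
move=> v0; rewrite dotmx_self lt0r sumr_ge0 ?andbT; last by move=> *; exact: exprn_ge0.
apply: contra v0; rewrite psumr_eq0 => [/allP v0|j _]; last exact: exprn_ge0.
apply/eqP/rowP => j; rewrite mxE; apply/eqP.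
by have := v0 j; rewrite mem_index_enum sqrf_eq0 normr_eq0; exact.
Qed.

(** Meant for [R[i]], where [0 <= - z] says that [z] is real and nonpositive. *)
Lemma coef_prod_XsubC_ge0 (K : numDomainType) (s : seq K) :
  (forall z, z \in s -> 0 <= - z) -> forall j, 0 <= (\prod_(z <- s) ('X - z%:P))`_j.
Proof.
elim: s => [|z s IHs] s0 j; first by rewrite big_nil coef1 ler0n.
have {}IHs k : 0 <= (\prod_(z <- s) ('X - z%:P))`_k.
  by apply: IHs => y ys; apply: s0; rewrite inE ys orbT.
rewrite big_cons mulrBl coefB coefXM coefCM -mulNr addr_ge0 //; first by case: ifP.
by rewrite mulr_ge0 // s0 ?mem_head.
Qed.

Lemma root_char_polyN (K : fieldType) (B : 'M[K]_n) z :
  reflect (exists2 v : 'rV_n, v *m B = - z *: v & v != 0) (root (char_poly (- B)) z).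
Proof.
rewrite -eigenvalue_root_char; apply: (iffP eigenvalueP) => -[v vB v0]; exists v => //.
  by rewrite scaleNr -vB mulmxN opprK.
by rewrite mulmxN vB scaleNr opprK.
Qed.

(** Over [R[i]] the polynomial splits. If [z] is a root, [- z] is an eigenvalue of [A], nonnegative
    by evaluating the form at an eigenvector. *)
Lemma psd_coef_char_poly A :
  symmetric_mx A -> psd A -> forall j, 0 <= (char_poly (- A))`_j.
Proof.
move=> symA psdA j; rewrite -(ler0c (_`_j)) -coef_map map_char_poly map_mxN.
set p := char_poly _.
have [s] := closed_field_poly_normal p.
rewrite (monicP (char_poly_monic _)) scale1r => ps; rewrite ps.
apply: coef_prod_XsubC_ge0 => z.
rewrite -root_prod_XsubC -ps => /root_char_polyN[v vA v0].
have := psd_complex A v symA psdA; rewrite vA -scalemxAl mxE.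
by rewrite pmulr_lge0 ?dotmx_gt0.
Qed.

Lemma horner_coef_ge0 (K : numDomainType) (p : {poly K}) x :
  p \is monic -> (forall j, 0 <= p`_j) -> 0 < x -> 0 < p.[x].
Proof.
move=> p1 p0 x0; rewrite horner_coef.
have p_neq0 := monic_neq0 p1; rewrite -size_poly_gt0 in p_neq0.
rewrite -(prednK p_neq0) big_ord_recr /= ltr_wpDl //.
  by apply: sumr_ge0 => j _; rewrite mulr_ge0 // exprn_ge0 // ltW.
by rewrite -lead_coefE (monicP p1) mul1r exprn_gt0.
Qed.

(** By the spectral theorem the form is a sum of squares weighted by eigenvalues. A negative
    eigenvalue [r] would give the positive root [- r] of a monic polynomial with nonnegative
    coefficients. *)
Lemma coef_char_poly_psd A :
  symmetric_mx A -> (forall j, 0 <= (char_poly (- A))`_j) -> psd A.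
Proof.
move=> symA p0.
have hA : rC A \is hermsymmx.
  apply/is_hermitianmxP; rewrite expr0 scale1r; apply/matrixP => i j.
  by rewrite !mxE -{1}symA mxE; symmetry; exact: conjc_real.
have AE := orthomx_spectralP (hermitian_normalmx hA).
have /mxOverP dR := hermitian_spectral_diag_real hA.
set P := spectralmx _ in AE; set d := spectral_diag _ in AE dR.
have uP : P \is unitarymx := spectral_unitarymx _.
have d0 i : 0 <= d 0 i.
  rewrite real_leNgt ?real0 ?dR //; apply/negP => di0.
  have /complex_realP[r dr] := dR 0 i.
  have : root (char_poly (- rC A)) (- (r%:C)%C).
    (* The rows of [P] are eigenvectors, nonzero because [P] is invertible. *)
    apply/root_char_polyN; exists (row i P); last first.
      apply: contra_neqT (oner_neq0 R[i]) => /negPn/eqP; rewrite rowE => dP.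
      have /rowP/(_ i) := congr1 (mulmx^~ (invmx P)) dP.
      by rewrite mulmxK ?unitarymx_unit // mul0mx !mxE !eqxx.
    rewrite opprK -dr -row_mul {1}AE !mulmxA mulmxV ?unitarymx_unit // mul1mx.
    by rewrite row_mul row_diag_mx -scalemxAl -rowE.
  rewrite -map_mxN -map_char_poly -rmorphN fmorph_root /root => /eqP pr.
  have := horner_coef_ge0 _ _ (- r) (char_poly_monic _) p0.
  by rewrite pr ltxx oppr_gt0 -ltcR -dr => /(_ di0).
move=> v; rewrite -ler0c.
pose w := rC v *m P^t*.
suff -> : ((v *m A *m v^T) 0 0)%:C%C = \sum_i d 0 i * `|w 0 i| ^+ 2.
  by apply: sumr_ge0 => i _; rewrite mulr_ge0 // exprn_ge0.
have vE : (rC v)^t* = rC v^T.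
  by apply/colP => j; rewrite !mxE; exact: conjc_real.
transitivity ((rC v *m rC A *m rC v^T) 0 0); first by rewrite -!map_mxM [RHS]mxE.
have -> : rC v *m rC A *m rC v^T = w *m diag_mx d *m w^t*.
  rewrite /w trmx_mul map_mxM trmxCK vE AE -invmx_unitary // !mulmxA.
  by [].
rewrite mul_mx_diag mxE; apply: eq_bigr => i _.
by rewrite !mxE normCK mulrCA mulrA.
Qed.
End PsdCharPoly.

(** * Partial derivatives and local minima of polynomial functions *)

Section PolynomialCalculus.
Context {R : realType} {m : nat}.
Implicit Types (f g : 'rV[R]_m -> R).

Lemma continuousDf (E : topologicalType) (f1 f2 : E -> R) :
  continuous f1 -> continuous f2 -> continuous (fun x => f1 x + f2 x).
Proof. by move=> c1 c2 x; apply: cvgD; [exact: c1 | exact: c2]. Qed.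

Lemma continuousMf (E : topologicalType) (f1 f2 : E -> R) :
  continuous f1 -> continuous f2 -> continuous (fun x => f1 x * f2 x).
Proof. by move=> c1 c2 x; apply: cvgM; [exact: c1 | exact: c2]. Qed.

Lemma continuousXf (E : topologicalType) (f1 : E -> R) n :
  continuous f1 -> continuous (fun x => f1 x ^+ n).
Proof.
move=> c1 x; apply: (@continuous_comp _ _ _ f1 (fun y => y ^+ n)); first exact: c1.
exact: exprn_continuous.
Qed.

Lemma pdeg_continuous d f : pdeg d f -> continuous f.
Proof.
elim=> [c a _|{}f g _ fc _ gc]; last exact: continuousDf.
apply: continuousMf; first exact: cst_continuous.
apply: continuous_big => [|i _]; first exact: mul_continuous.
by apply: continuousXf; exact: coord_continuous.
Qed.

(* [g] is the partial derivative of [f] along [e_i], read off from the linear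
   term of [f (x + t e_i)] as a polynomial in [t]. *)
Definition partial (i : 'I_m) f g : Prop := forall x, exists2 q : {poly R},
  (forall t, f (x + t *: delta_mx 0 i) = q.[t]) & q`_1 = g x.

Lemma partialD i f1 f2 g1 g2 : partial i f1 g1 -> partial i f2 g2 ->
  partial i (fun x => f1 x + f2 x) (fun x => g1 x + g2 x).
Proof.
move=> h1 h2 x; have [q1 q1P q1E] := h1 x; have [q2 q2P q2E] := h2 x.
by exists (q1 + q2) => [t|]; rewrite ?hornerD ?q1P ?q2P // coefD q1E q2E.
Qed.

Lemma partialZ i c f g : partial i f g -> partial i (fun x => c * f x) (fun x => c * g x).
Proof.
move=> h x; have [q qP qE] := h x.
by exists (c *: q) => [t|]; rewrite ?hornerZ ?qP // coefZ qE.
Qed.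

Lemma partial_mono i a : partial i (mono a)
  (fun x => (a i)%:R * mono (fun j => a j - (j == i))%N x).
Proof.
move=> x; pose r := \prod_(j | j != i) x 0 j ^+ a j.
exists (r *: ('X + (x 0 i)%:P) ^+ a i) => [t|].
  rewrite hornerZ !hornerE /mono (bigD1 i) //= !mxE !eqxx mulr1 [RHS]mulrC.
  congr (_ * _); first by rewrite addrC.
  by apply: eq_bigr => j /negPf ji; rewrite !mxE ji mulr0 addr0.
have coef1_horner (q : {poly R}) : q`_1 = q^`().[0].
  by rewrite horner_coef0 coef_deriv mulr1n.
rewrite coefZ coef1_horner deriv_exp derivD derivX derivC addr0 mul1r.
rewrite hornerMn horner_exp !hornerE ?add0r -mulr_natl mulrCA; congr (_ * _).
rewrite /mono (bigD1 i) //= eqxx subn1 mulrC; congr (_ * _).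
by apply: eq_bigr => j /negPf ji; rewrite ji subn0.
Qed.

Lemma pdeg_partial d f i : pdeg d f -> exists2 g, pdeg d g & partial i f g.
Proof.
elim=> [c a ad|f1 f2 _ [g1 g1d h1] _ [g2 g2d h2]]; last first.
  by exists (fun x => g1 x + g2 x); [exact: pdegD | exact: partialD].
exists (fun x => c * ((a i)%:R * mono (fun j => a j - (j == i))%N x)); last first.
  exact/partialZ/partial_mono.
apply: pdegZ; apply: pdeg_mono; apply: leq_trans ad.
by apply: leq_sum => j _; exact: leq_subr.
Qed.

(** If the linear coefficient [k] were nonzero, the step [t = - k / D] would gain [k ^ 2 / D] from
    the linear term, more than the remainder of order [1 / D ^ 2] once [D] is large. *)
Lemma poly_local_min (q : {poly R}) (r : R) :
  0 < r -> (forall t, `|t| < r -> q.[0] <= q.[t]) -> q`_1 = 0.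
Proof.
move=> r0 qmin; apply/eqP/negPn/negP => q10.
pose u := drop_poly 2 q; pose C := \sum_(j < size u) `|u`_j|.
have C0 : 0 <= C by apply: sumr_ge0.
have qE t : q.[t] = q.[0] + q`_1 * t + t ^+ 2 * u.[t].
  rewrite -[q in LHS](poly_take_drop 2) hornerD hornerM hornerXn [_ * t ^+ 2]mulrC.
  by rewrite horner_poly !big_ord_recl big_ord0 /= addr0 expr0 mulr1 expr1 horner_coef0.
have uC t : `|t| <= 1 -> `|u.[t]| <= C.
  move=> t1; rewrite horner_coef; apply: le_trans (ler_norm_sum _ _ _) _.
  apply: ler_sum => j _; rewrite normrM normrX ler_piMr //.
  by rewrite exprn_ile1.
set k := q`_1 in q10 qE; have k0 : 0 < `|k| by rewrite normr_gt0.
(* The summands of [D] ensure in turn that the remainder is dominated, that [|t| <= 1] so that [C]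
   bounds [u], and that [|t| < r]. *)
pose D := 1 + C + `|k| + `|k| / r.
have kr0 : 0 < `|k| / r by rewrite divr_gt0.
have D0 : 0 < D by rewrite /D; lra.
have tE : `|- k / D| = `|k| / D by rewrite normrM normrN normfV (gtr0_norm D0).
have t1 : `|- k / D| <= 1 by rewrite tE ler_pdivrMr // mul1r /D; lra.
have tr : `|- k / D| < r.
  by rewrite tE ltr_pdivrMr // mulrC -ltr_pdivrMr // /D; lra.
have := qmin _ tr; rewrite (qE (- k / D)) -addrA lerDl.
have -> : k * (- k / D) + (- k / D) ^+ 2 * u.[- k / D]
    = k ^+ 2 / D * (u.[- k / D] / D - 1) by field; exact: lt0r_neq0.
apply/negP; rewrite -ltNge pmulr_rlt0; last first.
  by rewrite divr_gt0 // exprn_even_gt0.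
rewrite subr_lt0 ltr_pdivrMr // mul1r.
apply: le_lt_trans (ler_norm _) _; apply: le_lt_trans (uC _ t1) _.
by rewrite /D; lra.
Qed.

Lemma local_min_partial i f g (y : 'rV[R]_m) : partial i f g ->
  (\forall z \near y, f y <= f z) -> g y = 0.
Proof.
move=> fg ymin; have [q qP <-] := fg y.
have /nbhs_ballP[r /= r0 rP] := ymin.
apply: (@poly_local_min q r) => // t tr.
rewrite -!qP scale0r addr0; apply: rP; split => [|a j] /=; first exact: r0.
rewrite !mxE.
rewrite -ball_normE /= opprD addNKr normrN normrM.
by apply: le_lt_trans tr; rewrite ler_piMr // normr_nat; case: (_ && _).
Qed.

Definition power_sum (n : nat) (x : 'rV[R]_m) : R := \sum_i x 0 i ^+ n.

Lemma pdeg_power_sum n : pdeg n (power_sum n).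
Proof. by apply: pdeg_sum => i _; exact: pdeg_coordX. Qed.

Lemma partial_power_sum i n : partial i (power_sum n.+1) (fun x => n.+1%:R * x 0 i ^+ n).
Proof.
move=> x; pose c := \sum_(j | j != i) x 0 j ^+ n.+1.
have [q qP qE] := partial_mono i (fun j => (j == i) * n.+1)%N x.
exists (q + c%:P) => [t|]; last first.
  rewrite coefD coefC addr0 qE eqxx mul1n; congr (_ * _).
  rewrite -(monoX i) /mono; apply: eq_bigr => j _.
  by case: eqP => _; rewrite ?mul1n ?subn1.
rewrite hornerD -qP hornerC monoX /power_sum (bigD1 i) //=; congr (_ + _).
by apply: eq_bigr => j /negPf ji; rewrite !mxE ji mulr0 addr0.
Qed.

Lemma power_sum_ge0 n (x : 'rV[R]_m) : ~~ odd n -> 0 <= power_sum n x.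
Proof. by move=> n_even; apply: sumr_ge0 => i _; rewrite exprn_even_ge0. Qed.

(** For even [n] each coordinate with [|x_i| > 1] satisfies [|x_i| <= x_i ^ n <= c], so the set is
    bounded. *)
Lemma compact_power_sum_le n c : (0 < n)%N -> ~~ odd n ->
  compact [set x | power_sum n x <= c]%classic.
Proof.
move=> n0 n_even; apply: bounded_closed_compact; last first.
  by apply: closed_sublevel; exact: pdeg_continuous (pdeg_power_sum n).
exists (1 + `|c|); split; first exact: num_real.
move=> M cM x /= xc; apply/ltW; apply: le_lt_trans cM.
rewrite [leLHS]/Num.Def.normr /= mx_normrE; apply: bigmax_le => [|[a i] _ /=]; first by rewrite addr_ge0.
rewrite ord1; have [x1|x1] := leP `|x 0 i| 1; first by rewrite (le_trans x1) // lerDl.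
have xn : `|x 0 i| <= x 0 i ^+ n.
  rewrite -[leRHS]ger0_norm ?exprn_even_ge0 // normrX -(prednK n0) exprS.
  by rewrite ler_peMr // exprn_ege1 // ltW.
apply: le_trans xn _; apply: le_trans (_ : power_sum n x <= _).
  by rewrite /power_sum (bigD1 i) //= lerDl sumr_ge0 // => j _; rewrite exprn_even_ge0.
by apply: le_trans xc _; apply: le_trans (ler_norm c) _; rewrite lerDr.
Qed.
End PolynomialCalculus.

(** * Counting sign patterns *)

Section SignPatterns.
Context {R : realType} {m : nat}.

(** The minimum of the positive values works; [1] serves when there are none. *)
Lemma positive_lower_bound (T : finType) (F : T -> R) :
  exists2 eta, 0 < eta & forall t, 0 < F t -> eta <= F t.
Proof.
exists (\big[Num.min/1]_(t | 0 < F t) F t) => [|t Ft]; last exact: bigmin_le_cond.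
by apply: lt_bigmin.
Qed.

Lemma upper_bound_exists (T : finType) (F : T -> R) : exists B, forall t, F t <= B.
Proof.
exists (\sum_t `|F t|) => t; apply: le_trans (ler_norm _) _.
by rewrite (bigD1 t) //= lerDl sumr_ge0.
Qed.


(* Each sign cell contains a critical point of one of the functions
   [power_sum + T * sum_(i in S) (f_i ^ 2 - e_i) ^ 2], [#|S| <= m], and each of
   those has at most [(4 * d + 1) ^ m] critical points. *)
Lemma card_strict_sign_patterns (I W : finType) (d : nat)
    (f : I -> 'rV[R]_m -> R) (theta : W -> 'rV[R]_m) :
  (forall i, pdeg d (f i)) -> (forall w i, f i (theta w) != 0) ->
  (forall w w', (forall i, (0 < f i (theta w)) = (0 < f i (theta w'))) -> w = w') ->
  (#|W| <= (\sum_(j < m.+1) 'C(#|I|, j)) * (4 * d).+1 ^ m)%N.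
Proof.
move=> f_deg f_neq0 theta_inj.
have [eta eta0 etaP] := positive_lower_bound _ (fun p : W * I => f p.2 (theta p.1) ^+ 2).
have f2_deg i : pdeg (d * 2) (fun x => f i x ^+ 2) by exact: pdegX.
(* As [e i < eta], every point [theta w] satisfies the constraints [e i <= f_i ^ 2]. *)
have [e [e_eta eP]] := generic_levels (d * 2) _ eta eta0 f2_deg.
(* An even exponent makes [h] proper, and its derivatives have degree [4 d + 1], above the bound
   [4 d] on those of [G S]. *)
pose h : 'rV[R]_m -> R := power_sum (4 * d).+2.
have h_even : ~~ odd (4 * d).+2 by rewrite /= negbK oddM.
pose G (S : {set I}) x := \sum_(i in S) (f i x ^+ 2 - e i) ^+ 2.
have G_deg S : pdeg (4 * d) (G S).
  apply: pdeg_sum => i _; rewrite (_ : 4 * d = (d * 2) * 2)%N; last by lia.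
  by apply: pdegX; apply: pdegB (f2_deg i) (pdeg_cst _ _).
have crit w : exists S : {set I}, (#|S| <= m)%N /\ exists T0, forall T, T0 <= T ->
    exists y, (forall i, (0 < f i y) = (0 < f i (theta w))) /\
      (\forall z \near y, h y + T * G S y <= h z + T * G S z).
  (* Flipping signs turns the cell of [theta w] into the region where all [s i * f i] are
     positive. *)
  pose s i : R := if 0 < f i (theta w) then 1 else -1.
  have s2 i : s i ^+ 2 = 1 by rewrite /s; case: ifP => _; rewrite ?expr1n ?sqrrN ?expr1n.
  have sf2 i x : (s i * f i x) ^+ 2 = f i x ^+ 2 by rewrite exprMn s2 mul1r.
  have := @penalty_local_min R _ I h (fun i x => s i * f i x) e (theta w).
  case=> [|x|c|i|i|i|i|x0].
  - exact: pdeg_continuous (pdeg_power_sum _).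
  - exact: power_sum_ge0.
  - exact: compact_power_sum_le.
  - by apply: (@pdeg_continuous _ _ d); exact: pdegZ.
  - by have /andP[] := e_eta i.
  - rewrite /s; case: ifPn => [|]; first by rewrite mul1r.
    by rewrite -leNgt le_eqVlt (negPf (f_neq0 w i)) /= mulN1r oppr_gt0.
  - rewrite sf2; have /andP[_ /ltW/le_trans] := e_eta i; apply.
    by apply: (etaP (w, i)); rewrite exprn_even_gt0 //= f_neq0.
  set S := [set i | _]; rewrite /= => -[T0 T0P]; exists S; split.
    by rewrite (_ : S = [set i | f i x0 ^+ 2 == e i]) //; apply/setP => i; rewrite !inE sf2.
  exists T0 => T /T0P[y [yf ymin]]; exists y; split => [i|].
    have := yf i; rewrite /s; case: ifP => _; first by rewrite mul1r.
    by rewrite mulN1r oppr_gt0 => /ltW; rewrite leNgt => /negPf.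
  have GE x : \sum_(i in S) ((s i * f i x) ^+ 2 - e i) ^+ 2 = G S x.
    by apply: eq_bigr => i _; rewrite sf2.
  by apply: filterS ymin => z; rewrite !GE.
pose S w := projT1 (cid (crit w)).
have Sm w : (#|S w| <= m)%N by rewrite /S; case: cid => ? [].
have crit_S w : exists T0, forall T, T0 <= T -> exists y,
    (forall i, (0 < f i y) = (0 < f i (theta w))) /\
    (\forall z \near y, h y + T * G (S w) y <= h z + T * G (S w) z).
  by rewrite /S; case: cid => ? [].
(* One [T] for all [w]: the points with the same active set are then critical for the same
   function. *)
have [T TP] := upper_bound_exists _ (fun w => projT1 (cid (crit_S w))).
have crit_T w : exists y, (forall i, (0 < f i y) = (0 < f i (theta w))) /\
    (\forall z \near y, h y + T * G (S w) y <= h z + T * G (S w) z).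
  by have := TP w; case: cid => T0 /= h0 /h0.
pose y w := projT1 (cid (crit_T w)).
have y_sign w i : (0 < f i (y w)) = (0 < f i (theta w)).
  by rewrite /y; case: cid => ? [].
have y_min w : \forall z \near y w,
    h (y w) + T * G (S w) (y w) <= h z + T * G (S w) z.
  by rewrite /y; case: cid => ? [].
have y_inj : injective y.
  by move=> w w' yy; apply: theta_inj => i; rewrite -!y_sign yy.
have fibre (U : {set I}) : (#|[set w | S w == U]| <= (4 * d).+1 ^ m)%N.
  have GU i := pdeg_partial _ _ i (G_deg U).
  pose g i := projT1 (cid2 (GU i)).
  have g_deg i : pdeg (4 * d) (g i) by rewrite /g; case: cid2.
  have gP i : partial i (G U) (g i) by rewrite /g; case: cid2.
  rewrite -card_sig.
  apply: (@card_triangular_system _ _ _ (fun t : {w | w \in [set w | S w == U]} => y (val t))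
    _ (fun i x => - (T / (4 * d).+2%:R) * g i x)).
  - by move=> t t' /y_inj/val_inj.
  - by move=> i; exact: pdegZ.
  - move=> i t; have := valP t; rewrite inE => /eqP St.
    have := y_min (val t); rewrite St => t_min.
    (* Vanishing of the derivative reads [(4 d + 2) x_i ^ (4 d + 1) + T g_i = 0], the required
       triangular form. *)
    have := local_min_partial _ _ _ _ (partialD _ _ _ _ _ (partial_power_sum i (4 * d).+1)
      (partialZ _ T _ _ (gP i))) t_min.
    have c0 : (4 * d).+2%:R != 0 :> R by rewrite pnatr_eq0.
    move/eqP; rewrite addr_eq0 => /eqP crit0.
    by apply: (mulfI c0); rewrite crit0; field.
rewrite -sum1_card (partition_big S (fun U : {set I} => #|U| <= m)%N) //=.
apply: leq_trans (_ : \sum_(U : {set I} | #|U| <= m) (4 * d).+1 ^ m <= _)%N.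
  apply: leq_sum => U _; apply: leq_trans (fibre U).
  by rewrite sum1_card; apply/eq_leq/eq_card => w; rewrite !inE.
rewrite sum_nat_const leq_mul2r; apply/orP; right.
(* The sets are grouped by cardinality; [inord] is faithful as [#|U| <= m]. *)
rewrite -sum1_card (partition_big (fun U : {set I} => inord #|U| : 'I_m.+1) predT) //=.
apply: leq_sum => j _; rewrite sum1_card -[#|I| in leqRHS]cardsT -cards_draws.
apply: subset_leq_card; apply/fintype.subsetP => U.
case/andP=> Um /eqP <-; rewrite inE finset.subsetT /=.
by rewrite inordK.
Qed.
(** Negative values that occur are at most [- eta], so adding [eta / 2] makes every value nonzero
    and turns [0 <= f] into [0 < f + eta / 2]. *)
Lemma card_sign_patterns (I W : finType) (d : nat)
    (f : I -> 'rV[R]_m -> R) (theta : W -> 'rV[R]_m) :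
  (forall i, pdeg d (f i)) ->
  (forall w w', (forall i, (0 <= f i (theta w)) = (0 <= f i (theta w'))) -> w = w') ->
  (#|W| <= (\sum_(j < m.+1) 'C(#|I|, j)) * (4 * d).+1 ^ m)%N.
Proof.
move=> f_deg theta_inj.
have [eta eta0 etaP] := positive_lower_bound _ (fun p : W * I => - f p.2 (theta p.1)).
have f_eta w i : (0 < f i (theta w) + eta / 2) = (0 <= f i (theta w)).
  have [f0|f0] := leP 0 (f i (theta w)); first by lra.
  by have /= := etaP (w, i); rewrite oppr_gt0 => /(_ f0); lra.
apply: (@card_strict_sign_patterns _ _ _ (fun i x => f i x + eta / 2) theta).
- by move=> i; apply: pdegD => //; exact: pdeg_cst.
- move=> w i; have [f0|f0] := leP 0 (f i (theta w)).
    by rewrite gt_eqF // f_eta.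
  by have /= := etaP (w, i); rewrite oppr_gt0 => /(_ f0) ?; rewrite lt_eqF //; lra.
- by move=> w w' ww'; apply: theta_inj => i; rewrite -!f_eta.
Qed.
End SignPatterns.

(** * Degrees of the coefficients of the characteristic polynomial *)

Section CharPolyDegree.
Context {R : realType} {m : nat}.

Definition coefs_pdeg (d : nat) (P : 'rV[R]_m -> {poly R}) : Prop :=
  forall j, pdeg d (fun x => (P x)`_j).

Lemma coefs_pdegM d e P P' : coefs_pdeg d P -> coefs_pdeg e P' ->
  coefs_pdeg (d + e) (fun x => P x * P' x).
Proof.
move=> Pd P'e j; apply: (@eq_pdeg _ _ _ (fun x => \sum_(k < j.+1) (P x)`_k * (P' x)`_(j - k))).
  by move=> x; rewrite coefM.
by apply: pdeg_sum => k _; exact: pdegM.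
Qed.

Lemma coefs_pdeg_prod d (I : finType) (P : I -> 'rV[R]_m -> {poly R}) :
  (forall i, coefs_pdeg d (P i)) -> coefs_pdeg (#|I| * d) (fun x => \prod_i P i x).
Proof.
rewrite -sum1_card => Pd; elim: (index_enum I) => [|i r IHr] j.
  apply: (eq_pdeg _ _ (pdeg_cst _ ((1 : {poly R})`_j))) => x.
  by rewrite big_nil.
rewrite big_cons mulnDl mul1n.
by apply: (eq_pdeg _ _ (coefs_pdegM _ _ _ _ (Pd i) IHr j)) => x; rewrite big_cons.
Qed.

(** Each Leibniz term is a product of [n] entries of [X + A], whose coefficients have degree at most
    [d] in [x]. *)
Lemma coefs_pdeg_char_poly n d (A : 'rV[R]_m -> 'M[R]_n) :
  (forall i j, pdeg d (fun x => A x i j)) ->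
  coefs_pdeg (n * d) (fun x => char_poly (- A x)).
Proof.
move=> Ad j.
apply: (@eq_pdeg _ _ _ (fun x => \sum_(s : 'S_n)
    (-1) ^+ s * (\prod_i char_poly_mx (- A x) i (s i))`_j)).
  move=> x; rewrite /char_poly /determinant coef_sum; apply: eq_bigr => s _.
  by rewrite !mulr_sign; case: ifP => _; rewrite ?coefN.
apply: pdeg_sum => s _; apply: pdegZ.
rewrite -[n in (n * d)%N]card_ord; move: j; apply: coefs_pdeg_prod => i j.
apply: (@eq_pdeg _ _ _ (fun x => ('X *+ (i == s i))`_j +  (j == 0%N)%:R * A x i (s i))).
  move=> x; rewrite !mxE coefB coefC; case: (j == 0%N).
    by rewrite mul1r opprK.
  by rewrite mul0r subr0 addr0.
by apply: pdegD; [exact: pdeg_cst | exact: pdegZ].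
Qed.
End CharPolyDegree.

(** * From shattered points to sign patterns *)

Section Shattering.
Context {R : realType} {m n : nat}.

(** Only [n] signs matter: the coefficient of index [n] is [1] and later ones vanish. *)
Lemma psd_char_polyP (A : 'M[R]_n) : symmetric_mx A ->
  psd A <-> forall k : 'I_n, 0 <= (char_poly (- A))`_k.
Proof.
move=> symA; split=> [psdA k|pA]; first exact: psd_coef_char_poly.
apply: coef_char_poly_psd => // j; have [jn|] := ltnP j n; first exact: (pA (Ordinal jn)).
rewrite leq_eqVlt => /predU1P[<-|nj].
  have := monicP (char_poly_monic (- A)).
  by rewrite lead_coefE size_char_poly => ->.
by rewrite nth_default // size_char_poly.
Qed.

(** The signs of the [N * n] coefficients determine the subset cut out, so the [2 ^ N] subsets yield
    distinct patterns. *)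
Lemma exp2_shattered_le N d (A : 'I_N -> 'rV[R]_m -> 'M[R]_n) :
  (forall i j k, pdeg d (fun x => A i x j k)) ->
  (forall i x, symmetric_mx (A i x)) ->
  (forall S : {set 'I_N}, exists x, forall i, ~ psd (A i x) <-> i \in S) ->
  (2 ^ N <= (\sum_(j < m.+1) 'C(N * n, j)) * (4 * (n * d)).+1 ^ m)%N.
Proof.
move=> Ad symA shat; pose theta S := projT1 (cid (shat S)).
have thetaP S i : ~ psd (A i (theta S)) <-> i \in S by rewrite /theta; case: cid.
pose f (p : 'I_N * 'I_n) x := (char_poly (- A p.1 x))`_p.2.
have -> : (2 ^ N)%N = #|{set 'I_N}|.
  by rewrite -cardsT -powersetT card_powerset cardsT card_ord.
have -> : (N * n)%N = #|{: 'I_N * 'I_n}| by rewrite card_prod !card_ord.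
apply: (@card_sign_patterns _ _ _ _ _ f theta) => [[i k]|S S' fS].
  exact: coefs_pdeg_char_poly.
have psdE i : psd (A i (theta S)) <-> psd (A i (theta S')).
  have [h1 h2] := psd_char_polyP _ (symA i (theta S)).
  have [h1' h2'] := psd_char_polyP _ (symA i (theta S')).
  split=> [/h1 h|/h1' h]; [apply: h2' => k | apply: h2 => k].
    by have := fS (i, k); rewrite /f /= => <-.
  by have := fS (i, k); rewrite /f /= => ->.
apply/setP => i; apply/idP/idP => /thetaP h; apply/thetaP => /psdE; exact: h.
Qed.
End Shattering.

(** * Numerical estimates *)

Section Numerics.
Context {R : realType}.

(** With [r = m / k <= 1] one has [r ^ m <= r ^ j] for [j <= m], so the sum times [r ^ m] is at most
    [(1 + r) ^ k <= expR (r k) = expR m]. *)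
Lemma sum_bin_le (k m : nat) : (0 < m <= k)%N ->
  (\sum_(j < m.+1) 'C(k, j))%:R <= (expR 1 * k%:R / m%:R) ^+ m :> R.
Proof.
case/andP=> m0 mk; have k0 : (0 < k)%N := leq_trans m0 mk.
pose r : R := m%:R / k%:R.
have r0 : 0 < r by rewrite divr_gt0 ?ltr0n.
have r1 : r <= 1 by rewrite ler_pdivrMr ?ltr0n // mul1r ler_nat.
have -> : expR 1 * k%:R / m%:R = expR 1 / r by rewrite /r invf_div mulrA.
rewrite expr_div_n ler_pdivlMr ?exprn_gt0 // natr_sum mulr_suml.
apply: (@le_trans _ _ ((1 + r) ^+ k)); last first.
  apply: (@le_trans _ _ (expR r ^+ k)).
    by rewrite lerXn2r ?nnegrE ?expR_ge0 ?expR_ge1Dx // addr_ge0 // ltW.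
  rewrite -!expRM_natl mulr1 /r mulrC divfK //.
  by rewrite pnatr_eq0 -lt0n.
rewrite exprDn (big_ord_widen k.+1 (fun j => 'C(k, j)%:R * r ^+ m)) //.
rewrite big_mkcond; apply: ler_sum => j _; rewrite expr1n mul1r.
case: ifP => [jm|_]; last by rewrite mulrn_wge0 // exprn_ge0 // ltW.
by rewrite -[leRHS]mulr_natl ler_wpM2l // ler_wiXn2l // ltW.
Qed.

Lemma vc_bound_ge (N n m : nat) : (0 < n)%N -> (0 < m)%N ->
  (2 ^ N <= (\sum_(j < m.+1) 'C(N * n, j)) * (4 * (n * 2)).+1 ^ m)%N ->
  N%:R <= vc_bound R m n.
Proof.
move=> n0 m0 patterns; set c := expR 1 : R.
have c2 : 2 <= c by have := expR_ge1Dx (1 : R); rewrite /c; lra.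
pose C : R := 4 * c * n%:R * 2 ^+ n.
have n1 : 1 <= n%:R :> R by rewrite ler1n.
have n2 : (n < 2 ^ n)%N := ltn_expl n (isT : 1 < 2)%N.
have pow2 : n%:R + 1 <= 2 ^+ n :> R by rewrite -natrX natr1 ler_nat.
have cn2 : 2 <= c * n%:R by nra.
have C16 : 2 ^+ 4 <= C.
  have : 2 * 2 <= c * n%:R * 2 ^+ n by apply: ler_pM => //; lra.
  by rewrite /C -[4 * c * _]mulrA -[4 * _ * _]mulrA; lra.
have C0 : 0 < C by apply: lt_le_trans C16; rewrite exprn_gt0.
have ln2 : 1 / 2 <= ln (2 : R).
  have := @le_ln1Dx R (- (1 / 2)); have -> : 1 + - (1 / 2) = 2^-1 :> R by field.
  by rewrite lnV ?posrE //; lra.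
have ln20 : 0 < ln (2 : R) by lra.
have mR : 0 < m%:R :> R by rewrite ltr0n.
rewrite /vc_bound /log2 -/C mulrA ler_pdivlMr //.
have lnC : 4 * ln 2 <= ln C.
  by rewrite mulr_natl -lnXn // ler_ln ?posrE // exprn_gt0.
(* For [N <= 8 m] the bound [C >= 2 ^ 4] already suffices, as [2 m log2 C >= 8 m]. *)
have [N8|N8] := leqP N (8 * m).
  have : N%:R <= 8 * m%:R :> R by rewrite -natrM ler_nat.
  nra.
(* With [z = N / m], the bound on patterns reads [2 ^ z <= (8 n + 1) e n z], and
   the right-hand side is at most [C * 2 z] since [8 n + 1 <= 8 * 2 ^ n]. *)
pose z : R := N%:R / m%:R.
have z8 : 8 < z by rewrite ltr_pdivlMr // -natrM ltr_nat.
have zE : N%:R = z * m%:R by rewrite /z divfK // lt0r_neq0.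
suff : z * ln 2 <= 2 * ln C by rewrite zE; nra.
(* Comes from [ln (z / 8) <= z / 8 - 1]. Half of [z ln 2] is spent here, whence the factor [2] in
   the final bound. *)
have ln2z : ln (2 * z) <= z / 2 * ln 2.
  have -> : 2 * z = 2 ^+ 4 * (1 + (z / 8 - 1)) by field.
  rewrite lnM ?posrE ?exprn_gt0 //; last by lra.
  rewrite lnXn //.
  have := @le_ln1Dx R (z / 8 - 1); nra.
pose X := c * n%:R * z * (8 * n%:R + 1).
have c0 : 0 < c by lra.
have nR : 0 < n%:R :> R by lra.
have z0 : 0 < z by lra.
have n81 : 0 < 8 * n%:R + 1 :> R by lra.
have cnz : 0 < c * n%:R * z := mulr_gt0 (mulr_gt0 c0 nR) z0.
have X0 : 0 < X by exact: mulr_gt0.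
have XC : X <= C * (2 * z).
  have -> : C * (2 * z) = c * n%:R * z * (8 * 2 ^+ n) by rewrite /C; ring.
  by rewrite ler_wpM2l ?(ltW cnz) //; lra.
have NX : 2 ^+ N <= X ^+ m.
  have -> : X ^+ m = (c * (N * n)%:R / m%:R) ^+ m * (4 * (n * 2)).+1%:R ^+ m.
    rewrite -exprMn -[_.+1%:R]natr1 !natrM /X /z; congr (_ ^+ _).
    by field; exact: lt0r_neq0.
  apply: (@le_trans _ _ ((\sum_(j < m.+1) 'C(N * n, j))%:R * (4 * (n * 2)).+1%:R ^+ m)).
    by rewrite -!natrX -natrM ler_nat.
  rewrite ler_wpM2r ?exprn_ge0 // sum_bin_le // m0 /=.
  by apply: leq_trans (leq_pmulr N n0); apply: ltnW (leq_ltn_trans (leq_pmull _ _) N8).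
have key : z * ln 2 <= ln (C * (2 * z)).
  apply: (@le_trans _ _ (ln X)); last by rewrite ler_ln ?posrE // mulr_gt0 //; lra.
  rewrite -(ler_pM2r mR) mulrAC -zE mulr_natl mulr_natr -!lnXn //.
  by rewrite ler_ln ?posrE ?exprn_gt0.
move: key; rewrite lnM ?posrE //; last by lra.
lra.
Qed.
End Numerics.

(** * The bound on the VC-dimension *)

Section VcDimension.
Context {R : realType} {n : nat}.

(** The surjection [param] lets a single row vector parametrise both settings, in particular the
    pairs [(x, y)]; degree [2] covers affine and bilinear dependence alike. *)
Lemma vc_dim_le_not_psd (m : nat) (P Th : Type) (Q : P -> Prop)
    (M : Th -> P -> 'M[R]_n) (param : 'rV[R]_m -> Th) :
  (0 < n)%N -> (0 < m)%N -> (forall th, exists x, param x = th) ->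
  (forall q j k, pdeg 2 (fun x => M (param x) q j k)) ->
  (forall th q, Q q -> symmetric_mx (M th q)) ->
  vc_dim_le Q (fun th q => ~ psd (M th q)) (vc_bound R m n).
Proof.
move=> n0 m0 param_surj M_deg M_sym N q [_ [qQ shat]]; apply: vc_bound_ge => //.
apply: (exp2_shattered_le _ _ (fun i x => M (param x) (q i))) => [i j k|i x|S].
- exact: M_deg.
- exact: M_sym.
- by have [th thP] := shat S; have [x xth] := param_surj th; exists x; rewrite xth.
Qed.

Lemma symmetric_mxD (A B : 'M[R]_n) :
  symmetric_mx A -> symmetric_mx B -> symmetric_mx (A + B).
Proof. by rewrite /symmetric_mx linearD /= => -> ->. Qed.

Lemma symmetric_mxZ c (A : 'M[R]_n) : symmetric_mx A -> symmetric_mx (c *: A).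
Proof. by rewrite /symmetric_mx linearZ /= => ->. Qed.

Lemma symmetric_mx_sum k (A : 'I_k -> 'M[R]_n) :
  (forall i, symmetric_mx (A i)) -> symmetric_mx (\sum_i A i).
Proof.
by rewrite /symmetric_mx => As; rewrite linear_sum; apply: eq_bigr => i _; exact: As.
Qed.
End VcDimension.

Theorem theorem3 (R : realType) (n l mx my : nat) (Q : 'rV[R]_l -> Prop)
  (hn : (0 < n)%N) (hl : (0 < l)%N) (hmx : (0 < mx)%N) (hmy : (0 < my)%N) :
  (* LMI setting: theta = x, m_theta = m_x *)
  (forall (F0 : 'rV[R]_l -> 'M[R]_n) (Fs : 'I_mx -> 'rV[R]_l -> 'M[R]_n),
     (forall q, Q q -> symmetric_mx (F0 q)) ->
     (forall i q, Q q -> symmetric_mx (Fs i q)) ->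
     vc_dim_le Q (fun (x : 'rV[R]_mx) q => ~ psd (F_lmi F0 Fs x q))
       (vc_bound R mx n))
  /\
  (* BMI setting: theta = (x, y), m_theta = m_x + m_y *)
  (forall (F0 : 'rV[R]_l -> 'M[R]_n) (Fs : 'I_mx -> 'rV[R]_l -> 'M[R]_n)
          (Gs : 'I_my -> 'rV[R]_l -> 'M[R]_n)
          (Hs : 'I_mx -> 'I_my -> 'rV[R]_l -> 'M[R]_n),
     (forall q, Q q -> symmetric_mx (F0 q)) ->
     (forall i q, Q q -> symmetric_mx (Fs i q)) ->
     (forall j q, Q q -> symmetric_mx (Gs j q)) ->
     (forall i j q, Q q -> symmetric_mx (Hs i j q)) ->
     vc_dim_le Q (fun (th : 'rV[R]_mx * 'rV[R]_my) q => ~ psd (F_bmi F0 Fs Gs Hs th q))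
       (vc_bound R (mx + my) n)).
Proof.
have deg1 m (j : 'I_m) (c : R) : pdeg 1 (fun x => x 0 j * c).
  exact: (pdegM 1 0 _ _ (pdeg_coord j) (pdeg_cst 0 c)).
split=> [F0 Fs symF0 symFs|F0 Fs Gs Hs symF0 symFs symGs symHs].
  apply: (@vc_dim_le_not_psd _ _ _ _ _ _ _ id) => // [th|q j k|th q qQ].
  - by exists th.
  - apply: (@eq_pdeg _ _ _ (fun x => F0 q j k + \sum_i x 0 i * Fs i q j k)) => [x|].
      by rewrite !mxE summxE; congr (_ + _); apply: eq_bigr => i _; rewrite mxE.
    apply: pdegD; first exact: pdeg_cst.
    by apply: pdeg_sum => i _; exact: pdegW (deg1 _ _ _).
  - apply: symmetric_mxD; first exact: symF0.
    by apply: symmetric_mx_sum => i; apply: symmetric_mxZ; exact: symFs.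
apply: (@vc_dim_le_not_psd _ _ (mx + my)%N _ _ _ _ (fun x => (lsubmx x, rsubmx x))).
- exact: hn.
- by rewrite addn_gt0 hmx.
- by case=> x y; exists (row_mx x y); rewrite row_mxKl row_mxKr.
- move=> q j k.
  apply: (@eq_pdeg _ _ _ (fun x => F0 q j k + \sum_i x 0 (lshift my i) * Fs i q j k
      + \sum_i x 0 (rshift mx i) * Gs i q j k
      + \sum_i \sum_i' x 0 (lshift my i) * x 0 (rshift mx i') * Hs i i' q j k)) => [x|].
    rewrite !mxE !summxE; congr (_ + _ + _ + _); apply: eq_bigr => i _; rewrite ?mxE //.
    by rewrite summxE; apply: eq_bigr => i' _; rewrite !mxE.
  apply: pdegD; first (apply: pdegD; first apply: pdegD).
  + exact: pdeg_cst.
  + by apply: pdeg_sum => i _; exact: pdegW (deg1 _ _ _).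
  + by apply: pdeg_sum => i _; exact: pdegW (deg1 _ _ _).
  + apply: pdeg_sum => i _; apply: pdeg_sum => i' _.
    (* The bilinear terms are the ones that force the degree [2]. *)
    exact: (pdegM 2 0 _ _ (pdegM 1 1 _ _ (pdeg_coord _) (pdeg_coord _)) (pdeg_cst 0 _)).
- move=> th q qQ; apply: symmetric_mxD; first (apply: symmetric_mxD; first apply: symmetric_mxD).
  + exact: symF0.
  + by apply: symmetric_mx_sum => i; apply: symmetric_mxZ; exact: symFs.
  + by apply: symmetric_mx_sum => i; apply: symmetric_mxZ; exact: symGs.
  + apply: symmetric_mx_sum => i; apply: symmetric_mx_sum => i'.
    by apply: symmetric_mxZ; exact: symHs.
Qed.
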